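(* Let $H$ be a finite-dimensional real Hilbert space and let $A:H\to H$ be a linear operator with $A=-A^*$. Consider the scheme with step $\tau>0$ $$\Bigl(I+\frac{1}{12}\tau^2A^2\Bigr)\frac{y^{n+1}-y^n}{\tau}+A\,\frac{y^{n+1}+y^n}{2}=0,\qquad n=0,1,\dots,N-1,\qquad y^0=u^0\in H,$$ where $I$ is the identity operator. Then the scheme provides a time-reversible computational algorithm and is unconditionally stable in $H$, i.e. for every $\tau>0$ one has $\|y^{n+1}\|\le\|y^n\|$, $n=0,1,\dots,N-1$, for all $u^0\in H$. Moreover, the scheme is conservative, $$\|y^{n+1}\|=\|y^n\|,\qquad n=0,1,\dots,N-1,$$ and multiconservative: for every constant linear operator $B:H\to H$ with $BA=AB$, $$\|By^{n+1}\|=\|By^n\|,\qquad n=0,1,\dots,N-1.$$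
   Context: The scheme approximates in time the Cauchy problem $\frac{du}{dt}+Au=0$, $u(0)=u^0$, where $A$ is a constant (time-independent) skew-symmetric operator (a discrete advection operator, linear in the transport velocity); it is referred to as the fourth-order accuracy scheme and corresponds, with $z=\tau A$, to the Padé approximation $\exp(-z)=\frac{1-\frac12 z+\frac1{12}z^2}{1+\frac12 z+\frac1{12}z^2}+\mathcal{O}(z^5)$. ''Constant'' for an operator means independent of time. The algorithm is time-reversible if, whenever $y^{n+1}$ is computed from $y^n$ by one step of the scheme and then the transport velocity is changed to the opposite (so that $A$ is replaced by $-A$), the next step of the scheme, started from $y^{n+1}$, yields a solution that coincides with $y^n$. Here it is understood that each step of the scheme determines $y^{n+1}$ uniquely from $y^n$. *)

(* Defs.v *)
From HB Require Import structures.
From mathcomp Require Import all_boot all_order all_algebra.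
From mathcomp Require Import reals.

Set Implicit Arguments.
Unset Strict Implicit.
Unset Printing Implicit Defensive.

Import Order.TTheory GRing.Theory Num.Theory.
Local Open Scope ring_scope.

Section Scheme.
Variables (R : realType) (H : vectType R).

(* The inner product of H is [dot : {dot H for idfun}]: conjugation is the
   identity, so that [dot] is bilinear, symmetric and positive definite. *)

Definition hnorm (dot : {dot H for idfun}) (x : H) : R := Num.sqrt (dot x x).

Definition is_adjoint (dot : {dot H for idfun}) (A A' : 'End(H)) : Prop :=
  forall x y : H, dot (A x) y = dot x (A' y).

Definition scheme_step (tau : R) (A : 'End(H)) (y y' : H) : Prop :=
  (\1 + (12^-1 * tau ^+ 2) *: (A \o A))%VF (tau^-1 *: (y' - y))
    + A (2^-1 *: (y' + y)) = 0.

(* Only the terms y 0, ..., y N of the sequence are constrained. *)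
Definition scheme_solution (tau : R) (A : 'End(H)) (N : nat) (u0 : H)
    (y : nat -> H) : Prop :=
  y 0%N = u0 /\ forall n : nat, (n < N)%N -> scheme_step tau A (y n) (y n.+1).

Definition step_well_defined (step : H -> H -> Prop) : Prop :=
  forall y : H, exists! y' : H, step y y'.

(* Reversing the transport velocity replaces A by - A. That each step determines
   its result uniquely is part of the notion, for both directions. *)
Definition time_reversible (step : 'End(H) -> H -> H -> Prop) (A : 'End(H))
    : Prop :=
  [/\ step_well_defined (step A),
      step_well_defined (step (- A))
    & forall y y' y'' : H, step A y y' -> step (- A) y' y'' -> y'' = y].

Definition unconditionally_stable (dot : {dot H for idfun}) (A : 'End(H))
    : Prop :=
  forall tau : R, 0 < tau ->
  forall (N : nat) (u0 : H) (y : nat -> H), scheme_solution tau A N u0 y ->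
  forall n : nat, (n < N)%N -> hnorm dot (y n.+1) <= hnorm dot (y n).

End Scheme.

(* Main.v *)
(* Write L(A) = I + tau^2 A^2 / 12 + tau A / 2, so that a step of the scheme reads
   L(A) y' = L(-A) y.  For skew-symmetric A, L(-A) is the adjoint of L(A) and
   commutes with it, so that |L(A) w| = |L(-A) w| for all w; in particular both
   operators are invertible, and exchanging A with -A exchanges y and y'.
   Writing y = L(A) w gives y' = L(-A) w, and an operator B commuting with A turns
   this into B y = L(A) (B w), B y' = L(-A) (B w), whence |B y| = |B y'|. *)
Require Import Defs.
From HB Require Import structures.
From mathcomp Require Import all_boot all_order all_algebra.
From mathcomp Require Import reals sesquilinear.
From mathcomp Require Import ring lra.

Set Implicit Arguments.
Unset Strict Implicit.
Unset Printing Implicit Defensive.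

Import Order.TTheory GRing.Theory Num.Theory.
Local Open Scope ring_scope.

Section SkewScheme.
Variables (R : realType) (H : vectType R).
Implicit Types (A B : 'End(H)) (tau : R).

(** At [z = tau A] this is the denominator of the Padé approximant of exp(-z); its numerator is
    [pade_op tau (- A)]. *)
Definition pade_op tau A : 'End(H) :=
  (\1 + (12^-1 * tau ^+ 2) *: (A \o A) + (2^-1 * tau) *: A)%VF.

Lemma pade_opE tau A x : pade_op tau A x =
  x + (12^-1 * tau ^+ 2) *: A (A x) + (2^-1 * tau) *: A x.
Proof. by rewrite /pade_op !(add_lfunE, scale_lfunE, comp_lfunE, id_lfunE). Qed.

Lemma pade_opNE tau A x : pade_op tau (- A) x =
  x + (12^-1 * tau ^+ 2) *: A (A x) - (2^-1 * tau) *: A x.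
Proof. by rewrite pade_opE !opp_lfunE [A (- _)]linearN opprK scalerN. Qed.

Lemma pade_op_comm tau A B x : (B \o A = A \o B)%VF ->
  B (pade_op tau A x) = pade_op tau A (B x).
Proof.
move=> comBA; have BA u : B (A u) = A (B u) by rewrite -!comp_lfunE comBA.
by rewrite !pade_opE !linearD !linearZ /= !BA.
Qed.

Lemma comm_lfunN A B : (B \o A = A \o B)%VF -> (B \o - A = - A \o B)%VF.
Proof. by move=> comBA; rewrite comp_lfunNr comp_lfunNl comBA. Qed.

(** Clear the denominator [tau] and sort by [y'] and [y]: the terms even in [A] come from [y' - y],
    the odd one from [y' + y], which leaves L(A) on [y'] and -L(-A) on [y]. *)
Lemma scheme_stepP tau A y y' : tau != 0 ->
  scheme_step tau A y y' <-> pade_op tau A y' = pade_op tau (- A) y.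
Proof.
move=> tau0; rewrite /scheme_step; set E := (X in X = 0).
pose c := 12^-1 * tau ^+ 2.
have tauE0 : tau *: E = 0 <-> E = 0.
  by split=> [/eqP|->]; rewrite ?scaler0 // scaler_eq0 (negPf tau0) => /eqP.
suff EE : tau *: E = pade_op tau A y' - pade_op tau (- A) y.
  rewrite -{}tauE0 {}EE; split=> [/eqP|->]; last exact: subrr.
  by rewrite subr_eq0 => /eqP.
have -> : tau *: E = (y' - y) + c *: A (A (y' - y)) + (2^-1 * tau) *: A (y' + y).
  rewrite /E add_lfunE scale_lfunE comp_lfunE id_lfunE -/c !linearZ /=.
  rewrite !scalerDr !scalerA mulrA mulfV // mul1r !scale1r.
  by rewrite [tau * _]mulrC.
rewrite pade_opE pade_opNE -/c !(linearB, linearD) /=.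
by rewrite opprK [X in X + _ = _]addrACA [LHS]addrACA.
Qed.

Lemma dot_eq0 (dot : {dot H for idfun}) x : dot x x = 0 -> x = 0.
Proof.
by move=> xx0; apply/eqP; apply: contra_eqT xx0 => /neq0_dnorm_gt0/lt0r_neq0.
Qed.

Variable (dot : {dot H for idfun}).

Lemma dotC x y : dot x y = dot y x.
Proof. by rewrite hermC /= expr0 mul1r. Qed.

(** Polarization; with p and q the parts of L(A) x even and odd in [A], equality of norms becomes
    orthogonality of p and q. *)
Lemma dnormD_subB p q : dot (p + q) (p + q) - dot (p - q) (p - q) = 4 * dot p q.
Proof.
rewrite !(linearDl, linearNl, linearDr, linearNr) /= (dotC q p).
by ring.
Qed.

Section Skew.
Variable (A : 'End(H)).
Hypothesis A_skew : forall x y, dot (A x) y = - dot x (A y).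

Lemma skew_dot0 x : dot x (A x) = 0.
Proof. by have := A_skew x x; rewrite dotC; lra. Qed.

Lemma dnorm_pade_op tau x :
  dot (pade_op tau A x) (pade_op tau A x)
  = dot (pade_op tau (- A) x) (pade_op tau (- A) x).
Proof.
apply/eqP; rewrite -subr_eq0 pade_opE pade_opNE dnormD_subB.
(* The two remaining products are instances of [skew_dot0], at [x] and at [A x]. *)
rewrite linearDl linearZl_LR !linearZr_LR /= [dot (A (A x)) _]dotC.
by rewrite !skew_dot0 !mulr0 addr0 mulr0.
Qed.

(** By equality of norms and definiteness, L(A) and L(-A) have the same kernel. On it their
    difference [tau *: A] vanishes, and where [A w = 0], L(A) fixes [w]. *)
Lemma pade_op_inj tau : tau != 0 -> injective (pade_op tau A).
Proof.
move=> tau0; suff ker0 w : pade_op tau A w = 0 -> w = 0.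
  by move=> x y Lxy; apply/subr0_eq/ker0; rewrite linearB /= Lxy subrr.
move=> Lw; have LNw : pade_op tau (- A) w = 0.
  by apply: (dot_eq0 (dot := dot)); rewrite -dnorm_pade_op Lw linear0l.
have /eqP : tau *: A w = 0.
  have -> : tau *: A w = pade_op tau A w - pade_op tau (- A) w.
    rewrite pade_opE pade_opNE opprB [RHS]addrC addrA subrK -scalerDl -mulrDl.
    by congr (_ *: _); field.
  by rewrite Lw LNw subr0.
rewrite scaler_eq0 (negPf tau0) /= => /eqP Aw0.
by move: Lw; rewrite pade_opE Aw0 linear0 !scaler0 !addr0.
Qed.

(** Finite dimension enters here: an injective endomorphism of [H] is onto. *)
Lemma pade_op_surj tau y : tau != 0 -> exists x, pade_op tau A x = y.
Proof.
move=> tau0; exists ((pade_op tau A)^-1%VF y).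
by apply/lker0_lfunVK/lker0P/pade_op_inj.
Qed.

Lemma scheme_step_well_defined tau : tau != 0 ->
  step_well_defined (scheme_step tau A).
Proof.
move=> tau0 y; have [y' Ly'] := pade_op_surj (pade_op tau (- A) y) tau0.
exists y'; split=> [|z]; first exact/scheme_stepP.
move/scheme_stepP=> /(_ tau0) Lz; apply: (pade_op_inj tau0).
by rewrite Ly' Lz.
Qed.

Lemma scheme_step_hnorm tau B y y' : tau != 0 -> (B \o A = A \o B)%VF ->
  scheme_step tau A y y' -> hnorm dot (B y') = hnorm dot (B y).
Proof.
move=> tau0 comBA; have comBNA := comm_lfunN comBA.
have comL : (pade_op tau (- A) \o A = A \o pade_op tau (- A))%VF.
  apply/lfunP=> u; rewrite !comp_lfunE pade_op_comm //.
  by rewrite comp_lfunNl comp_lfunNr.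
(* With y = L(A) w the step reads L(A) y' = L(-A) L(A) w = L(A) L(-A) w, and L(A) cancels. *)
have [w <-] := pade_op_surj y tau0; move/scheme_stepP => /(_ tau0).
rewrite (pade_op_comm _ _ comL) => /(pade_op_inj tau0) ->.
by rewrite /hnorm !pade_op_comm // dnorm_pade_op.
Qed.

End Skew.
End SkewScheme.

Theorem theorem8 (R : realType) (H : vectType R) (dot : {dot H for idfun})
    (A Astar : 'End(H)) (Astar_adj : is_adjoint dot A Astar)
    (A_skew : A = - Astar) :
  [/\ forall tau : R, 0 < tau -> time_reversible (scheme_step tau) A,
      unconditionally_stable dot A,
      forall tau : R, 0 < tau ->
        forall (N : nat) (u0 : H) (y : nat -> H),
        scheme_solution tau A N u0 y ->
        forall n : nat, (n < N)%N -> hnorm dot (y n.+1) = hnorm dot (y n)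
    & forall tau : R, 0 < tau ->
        forall (N : nat) (u0 : H) (y : nat -> H),
        scheme_solution tau A N u0 y ->
        forall B : 'End(H), (B \o A = A \o B)%VF ->
        forall n : nat, (n < N)%N ->
        hnorm dot (B (y n.+1)) = hnorm dot (B (y n))].
Proof.
have skew x y : dot (A x) y = - dot x (A y).
  by rewrite Astar_adj A_skew opp_lfunE linearNr opprK.
(* The reversed step is the scheme for [- A], so the lemmas on skew operators must apply to it
   too. *)
have skewN x y : dot ((- A) x) y = - dot x ((- A) y).
  by rewrite !opp_lfunE linearNl linearNr /= skew.
have isom (tau : R) B : 0 < tau -> (B \o A = A \o B)%VF ->
    forall N u0 y, scheme_solution tau A N u0 y ->
    forall n, (n < N)%N -> hnorm dot (B (y n.+1)) = hnorm dot (B (y n)).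
  move=> tau_gt0 comBA N u0 y [_ stepy] n /stepy.
  by apply: (scheme_step_hnorm skew) => //; exact: lt0r_neq0.
have norm (tau : R) : 0 < tau -> forall N u0 y, scheme_solution tau A N u0 y ->
    forall n, (n < N)%N -> hnorm dot (y n.+1) = hnorm dot (y n).
  move=> tau_gt0 N u0 y soly n ltnN.
  (* Conservation is the case where [B] is the identity. *)
  have com1A : (\1 \o A = A \o \1)%VF by rewrite comp_lfun1l comp_lfun1r.
  by have := isom tau _ tau_gt0 com1A N u0 y soly n ltnN; rewrite !id_lfunE.
split=> [tau /lt0r_neq0 tau0|tau tau_gt0 N u0 y soly n ltnN||].
- split=> [||y y' y'' /(scheme_stepP _ _ _ tau0) Ly' /(scheme_stepP _ _ _ tau0)].
  + exact: scheme_step_well_defined skew _ tau0.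
  + exact: scheme_step_well_defined skewN _ tau0.
  (* The two steps give L(-A) y'' = L(A) y' = L(-A) y, and L(-A) is injective. *)
  + by rewrite opprK Ly' => /(pade_op_inj skewN tau0).
- by rewrite (norm tau tau_gt0 N u0 y).
- exact: norm.
- by move=> tau tau_gt0 N u0 y soly B comBA n; apply: isom soly n.
Qed.
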